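(* For $x\in w$ let $\nu_k=(A(r,s,t;B)x)_k$, $k\in\mathbb{N}_0$. For each $j\in\mathbb{N}_0$ define the sequence $b^{(j)}=(b^{(j)}_n)_{n\in\mathbb{N}_0}$ of elements of $c_0(r,s,t,p;B)$ by $$b_n^{(j)}=\begin{cases}\displaystyle\sum_{k=j}^{n}(-1)^{k-j}\frac{(-v)^{n-k}}{u^{n-k+1}}\frac{D^{(s)}_{k-j}}{t_k}r_j & \text{if }0\le j\le n,\\ 0&\text{if }j>n,\end{cases}$$ and let $$b^{(-1)}_n=\sum_{j=0}^{n}\sum_{k=j}^{n}(-1)^{k-j}\frac{(-v)^{n-k}}{u^{n-k+1}}\frac{D^{(s)}_{k-j}}{t_k}r_j .$$ Then: (i) The sequence $(b^{(j)})_{j=0}^\infty$ is a (Schauder) basis for the space $X(r,s,t,p;B)$ for $X\in\{c_0(p),l(p)\}$, and any $x\in X(r,s,t,p;B)$ has a unique representation of the form $x=\sum_{j=0}^{\infty}\nu_jb^{(j)}$. (ii) The set $(b^{(j)})_{j=-1}^\infty$ is a (Schauder) basis for the space $c(r,s,t,p;B)$, and any $x\in c(r,s,t,p;B)$ has a unique representation of the form $x=\ell b^{(-1)}+\sum_{j=0}^\infty(\nu_j-\ell)b^{(j)}$, where $\ell=\lim_{n\to\infty}(A(r,s,t;B)x)_n$.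
   Context: Sequences are indexed by $\mathbb{N}_0=\{0,1,2,\dots\}$; $w$ is the space of all real or complex sequences. $p=(p_k)$ is a bounded sequence of strictly positive real numbers, $H=\sup_k p_k$, $M=\max\{1,H\}$. $c(p)=\{x\in w:\lim_k|x_k-l|^{p_k}=0\text{ for some }l\in\mathbb{C}\}$, $c_0(p)=\{x\in w:\lim_k|x_k|^{p_k}=0\}$, $l(p)=\{x\in w:\sum_k|x_k|^{p_k}<\infty\}$. $r=(r_n)$, $t=(t_n)$, $s=(s_n)$ are sequences in $w$ with $r_n\ne0$ and $t_n\neq 0$ for all $n$, and $s_0\neq0$; $u,v$ are nonzero scalars. $A(r,s,t)$ is the lower triangular infinite matrix with entries $s_{n-k}t_k/r_n$ for $0\le k\le n$ and $0$ for $k>n$. $B=B(u,v)=(b_{nk})$ is the matrix with $b_{nn}=u$, $b_{n,n-1}=v$ and all other entries $0$. $A(r,s,t;B)=A(r,s,t)\cdot B$ is the matrix product, so $$(A(r,s,t;B)x)_n=\frac1{r_n}\Big(\sum_{k=0}^{n-1}(s_{n-k}t_ku+s_{n-k-1}t_{k+1}v)x_k+s_0t_nu\,x_n\Big).$$ For $X\in\{c(p),c_0(p),l(p)\}$, $X(r,s,t,p;B)=\{x\in w:A(r,s,t;B)x\in X\}$, written $c(r,s,t,p;B)$, $c_0(r,s,t,p;B)$, $l(r,s,t,p;B)$. The first two carry the paranorm $h(x)=\sup_n|(A(r,s,t;B)x)_n|^{p_n/M}$ and the last the paranorm $\tilde h(x)=(\sum_n|(A(r,s,t;B)x)_n|^{p_n})^{1/M}$.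 $D^{(s)}_0=1/s_0$ and, for $n\ge1$, $D^{(s)}_n=s_0^{-(n+1)}\det(d_{ij})_{1\le i,j\le n}$ with $d_{ij}=s_{i-j+1}$ if $j\le i+1$ and $d_{ij}=0$ if $j>i+1$ (so the first row is $s_1,s_0,0,\dots,0$ and the last row is $s_n,s_{n-1},\dots,s_1$). A sequence $(b_n)$ in a (para)normed space is a Schauder basis if for each $x$ there is a unique sequence of scalars $(\mu_n)$ such that the (para)norm of $x-\sum_{n=0}^k\mu_nb_n$ tends to $0$ as $k\to\infty$; infinite sums are understood in this sense. *)

(* Defs.v *)
From HB Require Import structures.
From mathcomp Require Import all_boot all_order all_algebra.
From mathcomp Require Import complex.
From mathcomp Require Import all_classical all_reals all_analysis.
Import Order.TTheory GRing.Theory Num.Theory.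
Import numFieldNormedType.Exports.

Set Implicit Arguments.
Unset Strict Implicit.
Unset Printing Implicit Defensive.

Local Open Scope classical_set_scope.
Local Open Scope ring_scope.
Local Open Scope complex_scope.

(* The sequences are either all real or all complex. *)
Inductive scalar_kind := RealScalars | ComplexScalars.

Definition scalar_field (R : realType) (kd : scalar_kind) : numFieldType :=
  match kd with
  | RealScalars => (R : numFieldType)
  | ComplexScalars => (R[i] : numFieldType)
  end.

Definition to_complex (R : realType) (kd : scalar_kind) :
    scalar_field R kd -> R[i] :=
  match kd return scalar_field R kd -> R[i] with
  | RealScalars => fun x : R => x%:C
  | ComplexScalars => fun z : R[i] => z
  end.

Section InfiniteMatrices.
Variable K : fieldType.

(* [s n] is the entry s_n; the row and column indices start at 0. *)
Definition mxA (r s t : nat -> K) (n k : nat) : K :=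
  if (k <= n)%N then s (n - k)%N * t k / r n else 0.

Definition mxB (u v : K) (n k : nat) : K :=
  if k == n then u else if k.+1 == n then v else 0.

(* Product with a lower triangular infinite matrix on the left: row n of [P]
   vanishes after column n, so the sums over all indices stop at n. *)
Definition ltri_mul (P Q : nat -> nat -> K) (n k : nat) : K :=
  \sum_(0 <= j < n.+1) P n j * Q j k.

Definition ltri_apply (P : nat -> nat -> K) (x : nat -> K) (n : nat) : K :=
  \sum_(0 <= k < n.+1) P n k * x k.

Definition mxAB (r s t : nat -> K) (u v : K) : nat -> nat -> K :=
  ltri_mul (mxA r s t) (mxB u v).

Lemma ltri_apply_mxABE (r s t : nat -> K) (u v : K) (x : nat -> K) (n : nat) :
  ltri_apply (mxAB r s t u v) x n =
  (r n)^-1 * (\sum_(0 <= k < n)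
      (s (n - k)%N * t k * u + s (n - k.+1)%N * t k.+1 * v) * x k
    + s 0 * t n * u * x n).
Proof.
have entry k : (k <= n)%N -> mxAB r s t u v n k =
    mxA r s t n k * u + (if (k < n)%N then mxA r s t n k.+1 * v else 0).
  move=> kn; rewrite /mxAB /ltri_mul big_mkord.
  have kn1 : (k < n.+1)%N by [].
  rewrite (bigD1 (Ordinal kn1)) //= /mxB eqxx; congr (_ + _).
  case: ltnP => [ltkn|lenk].
    have kn2 : (k.+1 < n.+1)%N by [].
    rewrite (bigD1 (Ordinal kn2)) /=; last first.
      by rewrite -val_eqE /= gtn_eqF.
    rewrite ltn_eqF ?ltnSn // eqxx big1 ?addr0 // => i /andP[ik ik1].
    move: ik ik1; rewrite -!val_eqE /= => ik ik1.
    by rewrite eq_sym (negbTE ik) eq_sym (negbTE ik1) mulr0.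
  apply: big1 => i; rewrite -val_eqE /= => ik.
  rewrite eq_sym (negbTE ik); case: eqP => [e|]; last by rewrite mulr0.
  by have := ltn_ord i; rewrite -e ltnS ltnNge lenk.
rewrite /ltri_apply big_nat_recr //= mulrDr big_distrr /=; congr (_ + _).
  apply: eq_big_nat => k /andP[_ kn]; rewrite (entry _ (ltnW kn)) kn.
  rewrite /mxA (ltnW kn) kn.
  rewrite [RHS]mulrA [_^-1 * _]mulrDr.
  by rewrite !mulrA ![_^-1 * _]mulrC !(mulrAC _ _^-1).
rewrite (entry _ (leqnn n)) ltnn addr0 /mxA leqnn subnn.
by rewrite !mulrA [_^-1 * _]mulrC !(mulrAC _ _^-1).
Qed.

(* The determinant is indexed from 0 here; the difference i - j, hence the
   entry s_(i-j+1), is the same as with indices running from 1 to n. *)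
Definition coefD (s : nat -> K) (n : nat) : K :=
  if n is 0 then (s 0)^-1
  else (s 0 ^+ n.+1)^-1 *
    \det (\matrix_(i < n, j < n)
            (if (j <= i.+1)%N then s (i.+1 - j)%N else 0)).

Definition basis_term (r s t : nat -> K) (u v : K) (n j k : nat) : K :=
  (-1) ^+ (k - j) * ((- v) ^+ (n - k) / u ^+ (n - k).+1)
  * (coefD s (k - j) / t k) * r j.

Definition basis_seq (r s t : nat -> K) (u v : K) (j n : nat) : K :=
  if (j <= n)%N then \sum_(j <= k < n.+1) basis_term r s t u v n j k else 0.

Definition basis_seqN1 (r s t : nat -> K) (u v : K) (n : nat) : K :=
  \sum_(0 <= j < n.+1) \sum_(j <= k < n.+1) basis_term r s t u v n j k.

(* The family (b^(j)) for j >= -1, enumerated from its first index. *)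
Definition basis_seq_fromN1 (r s t : nat -> K) (u v : K) (m : nat) :
    nat -> K :=
  if m is j.+1 then basis_seq r s t u v j else basis_seqN1 r s t u v.

End InfiniteMatrices.

Section SequenceSpaces.
Variables (R : realType) (kd : scalar_kind).
Local Notation K := (scalar_field R kd).

Definition modulus (z : K) : R := Normc.normc (to_complex z).

Definition maddox_c (p : nat -> R) : set (nat -> K) :=
  [set x | exists l : R[i],
    (fun k => Normc.normc (to_complex (x k) - l) `^ p k) @ \oo --> (0 : R)].

Definition maddox_c0 (p : nat -> R) : set (nat -> K) :=
  [set x | (fun k => modulus (x k) `^ p k) @ \oo --> (0 : R)].

Definition maddox_l (p : nat -> R) : set (nat -> K) :=
  [set x | (\sum_(0 <= k <oo) (modulus (x k) `^ p k)%:E < +oo)%E].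

Definition mx_domain (P : nat -> nat -> K) (X : set (nat -> K)) :
    set (nat -> K) :=
  [set x | X (ltri_apply P x)].

Definition maddox_M (p : nat -> R) : R := Num.max 1 (sup (range p)).

(* The paranorms take values in the extended reals, so that they are given by
   the same formula on every sequence, inside the space or not. *)
Definition paranorm_sup (P : nat -> nat -> K) (p : nat -> R) (x : nat -> K) :
    \bar R :=
  ereal_sup (range (fun n : nat =>
    (modulus (ltri_apply P x n) `^ (p n / maddox_M p))%:E)).

Definition paranorm_sum (P : nat -> nat -> K) (p : nat -> R) (x : nat -> K) :
    \bar R :=
  ((\sum_(0 <= n <oo) (modulus (ltri_apply P x n) `^ p n)%:E)
     `^ (maddox_M p)^-1)%E.

Definition represents (g : (nat -> K) -> \bar R) (b : nat -> nat -> K)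
    (x : nat -> K) (mu : nat -> K) : Prop :=
  (fun k => g (x - \sum_(0 <= n < k.+1) mu n *: b n)) @ \oo --> (0 : \bar R)%E.

Definition schauder_basis (X : set (nat -> K)) (g : (nat -> K) -> \bar R)
    (b : nat -> nat -> K) : Prop :=
  (forall n, X (b n)) /\
  (forall x, X x -> exists! mu : nat -> K, represents g b x mu).

End SequenceSpaces.

(* Main.v *)
Require Import Defs.
From HB Require Import structures.
From mathcomp Require Import all_boot all_order all_algebra.
From mathcomp Require Import complex.
From mathcomp Require Import all_classical all_reals all_analysis.
From mathcomp Require Import ring zify.
Import Order.TTheory GRing.Theory Num.Theory.
Import numFieldNormedType.Exports.

(** The matrix P = A(r,s,t) B(u,v) is lower triangular and invertible, and the
    sequences of the theorem are the preimages of the simplest ones: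
    P b^(j) = e_j is the j-th unit sequence and P b^(-1) = (1, 1, 1, ...)
    ([ltri_apply_basis_seq], [ltri_apply_basis_seqN1]).  This rests on the fact
    that the numbers (-1)^i D_i invert the Toeplitz matrix (s_(n-k)), which is
    Cramer's rule ([coefD_convolution]), and on the explicit inverse of the
    bidiagonal matrix B ([mxB_inverse]).

    Both paranorms see a sequence only through its image under P, so everything
    happens in the Maddox spaces.  The image of x - sum_(j <= k) nu_j b^(j)
    vanishes up to index k and agrees with nu = P x beyond it; its paranorm
    tends to 0 because in c_0(p) it is the supremum of a tail of a null sequence
    ([paranorm_sup_tail]), and in l(p) it is the M-th root of the tail of
    a convergent series ([paranorm_sum_tail]).  Conversely either paranorm
    controls every coordinate of the image, and the n-th coordinate of the k-th
    remainder does not depend on k >= n; it must be 0, which determines the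
    coefficients ([coordinate_eq0]).

    For c(p), boundedness of the exponents makes |nu_n - l|^(p_n) -> 0 imply
    nu_n -> l ([maddox_c0_modulus]), so l is the ordinary limit, and the
    expansion is that of the c_0(p) sequence nu - l.  For uniqueness the
    coordinates give mu_j = nu_j - mu_0, and smallness of one remainder bounds
    |nu_n - mu_0|^(p_n / M) for all large n at once, whence mu_0 is again
    the limit of nu ([representsN1_unique]). *)

Set Implicit Arguments.
Unset Strict Implicit.
Unset Printing Implicit Defensive.

Local Open Scope classical_set_scope.
Local Open Scope ring_scope.

(** * The inverse matrix and the images of the basis sequences *)

Section InverseMatrix.
Variable K : numFieldType.
Implicit Types (r s t x y z : nat -> K) (u v : K).

Lemma ltri_applyD P x y n :
  ltri_apply P (x + y) n = ltri_apply P x n + ltri_apply P y n.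
Proof.
by rewrite /ltri_apply -big_split; apply: eq_bigr => k _; exact: mulrDr.
Qed.

Lemma ltri_applyZ P (a : K) x n :
  ltri_apply P (a *: x) n = a * ltri_apply P x n.
Proof.
rewrite /ltri_apply big_distrr; apply: eq_bigr => k _ /=.
by rewrite scalrfctE mulrCA.
Qed.

Lemma ltri_apply_sum P (m : nat) (f : nat -> nat -> K) n :
  ltri_apply P (\sum_(0 <= j < m) f j) n =
  \sum_(0 <= j < m) ltri_apply P (f j) n.
Proof.
elim: m => [|m IH]; last by rewrite !big_nat_recr //= ltri_applyD IH.
by rewrite !big_geq // /ltri_apply big1 // => k _; rewrite mulr0.
Qed.

Lemma ltri_applyB P x y n :
  ltri_apply P (x - y) n = ltri_apply P x n - ltri_apply P y n.
Proof. by rewrite ltri_applyD -scaleN1r ltri_applyZ mulN1r. Qed.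

Lemma eq_ltri_apply P x y n :
  (forall k, (k <= n)%N -> x k = y k) -> ltri_apply P x n = ltri_apply P y n.
Proof.
by move=> xy; apply: eq_big_nat => k /andP[_ kn]; rewrite xy.
Qed.

Lemma ltri_apply_mul P Q x n :
  (forall j k, (j < k)%N -> Q j k = 0) ->
  ltri_apply (ltri_mul P Q) x n = ltri_apply P (ltri_apply Q x) n.
Proof.
move=> Q0; rewrite /ltri_apply /ltri_mul.
under eq_bigr do rewrite big_distrl /=.
rewrite exchange_big /=; apply: eq_big_nat => j /andP[_ jn].
rewrite big_distrr /= [LHS](big_cat_nat (n := j.+1)) //= [X in _ + X]big_nat.
rewrite [X in _ + X]big1 ?addr0; last first.
  by move=> k /andP[jk _]; rewrite Q0 // mulr0 mul0r.
by apply: eq_bigr => k _; rewrite mulrA.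
Qed.

Lemma ltri_apply_mxB u v x n :
  ltri_apply (mxB u v) x n = u * x n + (if n is m.+1 then v * x m else 0).
Proof.
have zero k m : (m < k)%N ->
    \sum_(0 <= i < m) mxB u v k i * x i = 0.
  move=> mk; rewrite big_nat big1 // => i /andP[_ im].
  by rewrite /mxB !ltn_eqF ?mul0r //; lia.
rewrite /ltri_apply; case: n => [|n].
  by rewrite big_nat1 /mxB eqxx addr0.
by rewrite 2?big_nat_recr //= zero // /mxB eqxx ltn_eqF // add0r addrC.
Qed.

(** The entries of the inverse of the bidiagonal matrix are those of the
    geometric expansion of 1/(u + v S), where S is the shift. *)
Lemma mxB_inverse u v y n : u != 0 ->
  ltri_apply (mxB u v) (fun m =>
    \sum_(0 <= k < m.+1) (- v) ^+ (m - k) / u ^+ (m - k).+1 * y k) n = y n.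
Proof.
move=> u0; rewrite ltri_apply_mxB big_nat_recr //= subnn expr0 expr1.
rewrite mulrDr mul1r mulVKf //; case: n => [|n].
  by rewrite big_geq // mulr0 add0r addr0.
rewrite addrAC !big_distrr /= -big_split big_nat big1 ?add0r //= => k.
rewrite ltnS => kn; rewrite subSn // [in X in X + _]exprS [u ^+ _.+2]exprS.
by rewrite invfM; field; rewrite expf_neq0 u0.
Qed.

(** The numbers (-1)^i D_i are the solution z of the triangular Toeplitz system
    with right-hand side e_0: by Cramer's rule z_n is, up to the determinant
    s_0^(n+1), the cofactor at (0, n) of the Toeplitz matrix of size n + 1, and
    deleting row 0 and column n leaves the Hessenberg matrix that defines
    D_n. *)
Lemma toeplitz_solution_coefD s z n : s 0%N != 0 ->
  (forall m, (m <= n)%N ->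
     \sum_(0 <= i < m.+1) s (m - i)%N * z i = (m == 0%N)%:R) ->
  z n = (-1) ^+ n * Defs.coefD s n.
Proof.
move=> s0 zP.
pose T : 'M[K]_n.+1 :=
  \matrix_(i, j) if (j <= i)%N then s (i - j)%N else 0.
have detT : \det T = (s 0%N) ^+ n.+1.
  rewrite det_trig; last first.
    by apply/is_trig_mxP => i j ij; rewrite mxE leqNgt ij.
  under eq_bigr do rewrite mxE leqnn subnn.
  by rewrite prodr_const card_ord.
pose Z : 'cV[K]_n.+1 := \col_i z i.
have TZ : T *m Z = delta_mx 0 0.
  apply/matrixP => i j; rewrite !mxE ord1 eqxx andbT -[i == 0]/(i == 0%N :> nat).
  have in1 : (i < n.+1)%N by [].
  rewrite -zP -1?ltnS // [RHS]big_mkord (big_ord_widen _ (fun k => s (i - k)%N * z k) in1).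
  rewrite [RHS]big_mkcond /=; apply: eq_bigr => k _; rewrite !mxE ltnS.
  by case: ifP => _; rewrite ?mul0r.
have minorT : \det T * z n = (-1) ^+ n * (s 0%N ^+ n.+1 * Defs.coefD s n).
  transitivity ((\adj T *m (T *m Z)) ord_max 0).
    by rewrite mulmxA mul_adj_mx mul_scalar_mx !mxE.
  rewrite TZ mxE (bigD1 0) //= big1 => [|i /negPf i0]; last first.
    by rewrite [delta_mx _ _ _ _]mxE i0 mulr0.
  rewrite mxE [delta_mx _ _ _ _]mxE !eqxx mulr1 addr0 /cofactor add0n.
  rewrite /T {Z TZ detT T zP}.
  congr (_ * _); case: n => [|n] /=.
    by rewrite det_mx00 expr1 divff.
  rewrite mulrA divff ?expf_neq0 // mul1r; congr (\det _).
  apply/matrixP => i j; rewrite !mxE.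
  by rewrite /= /bump leq0n (leqNgt n.+1) ltn_ord.
apply: (mulfI (expf_neq0 n.+1 s0)).
by rewrite -detT minorT detT mulrCA.
Qed.

Lemma toeplitz_solvable s N : s 0%N != 0 -> exists z : nat -> K,
  forall m, (m <= N)%N ->
    \sum_(0 <= i < m.+1) s (m - i)%N * z i = (m == 0%N)%:R.
Proof.
move=> s0; elim: N => [|N [z zP]].
  exists (fun=> (s 0%N)^-1) => m; rewrite leqn0 => /eqP ->.
  by rewrite big_nat1 subnn divff.
pose c := - (s 0%N)^-1 * \sum_(0 <= i < N.+1) s (N.+1 - i)%N * z i.
exists (fun i => if (i <= N)%N then z i else c) => m.
rewrite leq_eqVlt => /predU1P[->|]; last rewrite ltnS => mN.
  rewrite big_nat_recr //= ltnn subnn /c mulrA mulrN divff // mulN1r.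
  apply/eqP; rewrite subr_eq0; apply/eqP/eq_big_nat => i /andP[_].
  by rewrite ltnS => ->.
rewrite -zP //; apply: eq_big_nat => i /andP[_].
by rewrite ltnS => im; rewrite (leq_trans im).
Qed.

Lemma coefD_convolution s m : s 0%N != 0 ->
  \sum_(0 <= i < m.+1) s (m - i)%N * ((-1) ^+ i * Defs.coefD s i) = (m == 0%N)%:R.
Proof.
move=> s0; have [z zP] := toeplitz_solvable m s0.
rewrite -(zP m) //; apply: eq_big_nat => i /andP[_]; rewrite ltnS => im.
by rewrite -(@toeplitz_solution_coefD s z) // => k ki; apply: zP; lia.
Qed.

(** The sequence b^(j) is obtained by undoing first the Toeplitz factor and
    then the bidiagonal one, starting from the unit sequence e_j. *)
Lemma ltri_apply_basis_seq r s t u v j n : (forall k, r k != 0) ->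
  (forall k, t k != 0) -> s 0%N != 0 -> u != 0 ->
  ltri_apply (mxAB r s t u v) (basis_seq r s t u v j) n = (n == j)%:R.
Proof.
move=> r0 t0 s0 u0.
pose y k : K :=
  if (j <= k)%N then (-1) ^+ (k - j) * (Defs.coefD s (k - j) / t k) * r j else 0.
have By m : basis_seq r s t u v j m =
    \sum_(0 <= k < m.+1) (- v) ^+ (m - k) / u ^+ (m - k).+1 * y k.
  rewrite /basis_seq; case: leqP => [jm|mj].
    rewrite [RHS](big_cat_nat (n := j)) //=; last exact: leqW.
    rewrite [X in _ = X + _]big_nat [X in _ = X + _]big1 ?add0r; last first.
      by move=> k /= kj; rewrite /y leqNgt kj mulr0.
    apply: eq_big_nat => k /andP[jk _]; rewrite /basis_term /y jk.
    by rewrite [(-1) ^+ _ * (_ / _)]mulrC -!mulrA.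
  rewrite big_nat big1 // => k /= km.
  by rewrite /y leqNgt (leq_trans km) // mulr0.
rewrite ltri_apply_mul; last first.
  by move=> i k ik; rewrite /mxB !gtn_eqF // ltnW.
rewrite (@eq_ltri_apply _ _ y) => [|k _]; last first.
  rewrite -[RHS](mxB_inverse v y k u0); apply: eq_ltri_apply => m _.
  exact: By.
have [nj|jn] := ltnP n j.
  rewrite ltn_eqF // /ltri_apply big_nat big1 // => k /= kn.
  by rewrite /y leqNgt (leq_ltn_trans _ nj) ?mulr0.
rewrite /ltri_apply (big_cat_nat (n := j)) //=; last exact: leqW.
rewrite big_nat big1 ?add0r; last first.
  by move=> k /= kj; rewrite /y leqNgt kj mulr0.
rewrite -{1}[j]add0n big_addn subSn //.
transitivity ((r n)^-1 * r j * ((n - j == 0)%N)%:R).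
  rewrite -(coefD_convolution (n - j) s0) big_distrr /=; apply: eq_big_nat => i.
  rewrite ltnS => /andP[_ inj]; rewrite /y /mxA leq_addl addnK.
  have -> : (i + j <= n)%N by lia.
  have -> : (n - (i + j) = n - j - i)%N by lia.
  by field; rewrite r0 t0.
rewrite subn_eq0 eqn_leq jn andbT; case: leqP => [nj|]; last by rewrite mulr0.
have -> : n = j by lia.
by rewrite mulVf ?mulr1.
Qed.

Lemma ltri_apply_basis_seqN1 r s t u v n : (forall k, r k != 0) ->
  (forall k, t k != 0) -> s 0%N != 0 -> u != 0 ->
  ltri_apply (mxAB r s t u v) (basis_seqN1 r s t u v) n = 1.
Proof.
move=> r0 t0 s0 u0.
(* Up to index n, the sequence b^(-1) is the finite sum of the b^(j), j <= n. *)
rewrite (@eq_ltri_apply _ _ (\sum_(0 <= j < n.+1) basis_seq r s t u v j)).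
  rewrite ltri_apply_sum big_nat_recr //= big_nat big1 => [|j /= jn].
    by rewrite ltri_apply_basis_seq // eqxx add0r.
  by rewrite ltri_apply_basis_seq // gtn_eqF.
move=> k kn; rewrite fct_sumE (big_cat_nat (n := k.+1)) //=.
rewrite [X in _ = _ + X]big_nat [X in _ = _ + X]big1 ?addr0; last first.
  by move=> j /andP[kj _]; rewrite /basis_seq leqNgt kj.
apply: eq_big_nat => j /andP[_]; rewrite ltnS => jk.
by rewrite /basis_seq jk.
Qed.

End InverseMatrix.

(** * Powers with variable exponents and null sequences *)

Section NullSequences.
Variable R : realType.

(** Exponents bounded below are harmless for a null sequence [a]: once
    [a n <= 1], a larger exponent only makes the power smaller. *)
Lemma cvg0_powR (a e : nat -> R) (c : R) : 0 < c ->
  (forall n, c <= e n) -> (forall n, 0 <= a n) ->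
  a @ \oo --> (0 : R) -> (fun n => a n `^ e n) @ \oo --> (0 : R).
Proof.
move=> c0 ce a0 /cvgrPdist_le acvg; apply/cvgrPdist_le => eps eps0.
pose m := Num.min 1 eps.
have m0 : 0 < m by rewrite lt_min ltr01.
have d0 : 0 < m `^ c^-1 by rewrite powR_gt0.
have d1 : m `^ c^-1 <= 1.
  apply: (@le_trans _ _ (1 `^ c^-1)); last by rewrite powR1.
  by rewrite ge0_ler_powR ?nnegrE ?invr_ge0 ?(ltW m0) ?(ltW c0) // /m ge_min lexx.
have := acvg _ d0; apply: filterS => n; rewrite !sub0r !normrN.
rewrite !ger0_norm ?powR_ge0 // => an.
have e0 : 0 < e n by exact: lt_le_trans (ce n).
apply: (@le_trans _ _ ((m `^ c^-1) `^ e n)).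
  by rewrite ge0_ler_powR ?nnegrE ?(ltW e0) ?(ltW d0).
apply: (@le_trans _ _ ((m `^ c^-1) `^ c)).
  by rewrite ger_powR // d0.
by rewrite -powRrM mulVf ?gt_eqF // powRr1 ?(ltW m0) // /m ge_min lexx orbT.
Qed.

Lemma cvge0P (f : nat -> \bar R) : (forall n, 0 <= f n)%E ->
  f @ \oo --> (0 : \bar R)%E <->
  (forall eps : R, 0 < eps -> \forall n \near \oo, (f n <= eps%:E)%E).
Proof.
move=> f0; split => [/fine_cvgP[ffin /cvgrPdist_le fcvg] eps eps0|fle].
  near=> n; have : `|0 - fine (f n)| <= eps by near: n; exact: fcvg.
  rewrite sub0r normrN ger0_norm ?fine_ge0 // -lee_fin fineK //.
  by near: n.
have fin eps n : (f n <= eps%:E)%E -> f n \is a fin_num.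
  by move=> fn; rewrite ge0_fin_numE // (le_lt_trans fn) ?ltry.
apply/fine_cvgP; split.
  by apply: filterS (fle 1 ltr01) => n; exact: fin.
apply/cvgrPdist_le => eps eps0; apply: filterS (fle _ eps0) => n fn.
by rewrite sub0r normrN ger0_norm ?fine_ge0 //= -lee_fin fineK ?(fin eps).
Unshelve. all: by end_near.
Qed.

End NullSequences.

(** * Real and complex scalars *)

Section Scalars.
Variables (R : realType) (kd : scalar_kind).
Local Notation K := (scalar_field R kd).
Implicit Types x y z : K.

Lemma modulus_ge0 z : 0 <= modulus z.
Proof. by rewrite /modulus; case: (to_complex z) => a b; exact: sqrtr_ge0. Qed.

Lemma modulus_eq0 z : (modulus z == 0) = (z == 0).
Proof.
rewrite /modulus; case: kd z => /= z.
  by rewrite expr0n /= addr0 sqrtr_sqr normr_eq0.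
apply/eqP/eqP => [/Normc.eq0_normc //|->].
by rewrite /= expr0n /= addr0 sqrtr0.
Qed.

Lemma modulus0 : modulus (0 : K) = 0.
Proof. by apply/eqP; rewrite modulus_eq0. Qed.

Lemma to_complexB x y : to_complex (x - y) = to_complex x - to_complex y.
Proof. by case: kd x y => //= x y; rewrite rmorphB. Qed.

Lemma cvg_modulus (f : nat -> K) (l : K) :
  (fun n => modulus (f n - l)) @ \oo --> (0 : R) -> f @ \oo --> l.
Proof.
move=> /cvgrPdist_lt fl; apply/cvgrPdist_lt => eps eps0.
have [d d0 dP] : exists2 d : R, 0 < d &
    forall z : K, modulus z < d -> `|z| < eps.
  rewrite /modulus; case: kd {f l fl} eps eps0 => /= eps eps0.
    by exists eps => // z; rewrite expr0n /= addr0 sqrtr_sqr.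
  exists (complex.Re eps) => [|z].
    by move: eps0; rewrite ltcE => /andP[].
  by rewrite normc_def ltcE; move: eps0; rewrite ltcE; case: z => a b /andP[/= -> _].
apply: filterS (fl _ d0) => n; rewrite sub0r normrN ger0_norm ?modulus_ge0 //.
by rewrite distrC; exact: dP.
Qed.

(** For real sequences the complex limit in the definition of c(p) may be
    replaced by its real part. *)
Lemma maddox_c_limit (p : nat -> R) (y : nat -> K) :
  (forall k, 0 < p k) -> maddox_c p y ->
  exists l : K, maddox_c0 p (fun k => y k - l).
Proof.
move=> p0 [l ly].
have [l' l'P] : exists l' : K, forall z : K,
    modulus (z - l') <= Normc.normc (to_complex z - l).
  rewrite /modulus; case: kd {y ly} => /=; last by exists l.
  case: l => a b; exists a => z /=.
  rewrite expr0n /= addr0; apply: ler_wsqrtr.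
  by rewrite lerDl sqr_ge0.
exists l'; rewrite /maddox_c0 /=.
apply: (@squeeze_cvgr _ _ _ _ (cst 0) _ _ _ _ (cvg_cst _) ly).
apply: nearW => k; rewrite powR_ge0 /= ge0_ler_powR ?nnegrE ?modulus_ge0 //.
- exact: ltW.
- exact: le_trans (modulus_ge0 _) (l'P _).
Qed.

End Scalars.

(** * The two paranorms *)

Section Paranorms.
Variables (R : realType) (kd : scalar_kind).
Local Notation K := (scalar_field R kd).
Variable p : nat -> R.
Hypotheses (p_bounded : bounded_fun p) (p_gt0 : forall k, 0 < p k).
Variable P : nat -> nat -> K.
Implicit Types (x y : nat -> K) (X : nat -> nat -> K).
Local Notation M := (maddox_M p).

Lemma maddox_M_gt0 : 0 < M.
Proof. by rewrite lt_max ltr01. Qed.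

Lemma le_maddox_M k : p k <= M.
Proof.
rewrite le_max; apply/orP; right; apply: sup_upper_bound; last by exists k.
by split; [exists (p k); exists k | exact: bounded_fun_has_ubound p_bounded].
Qed.

Let pM_gt0 n : 0 < p n / M.
Proof. by rewrite divr_gt0 ?maddox_M_gt0. Qed.

(** The exponent 1/p_n is at least 1/M, hence convergence in c_0(p) is stronger
    than ordinary convergence to 0. *)
Lemma maddox_c0_modulus y :
  maddox_c0 p y -> (fun n => modulus (y n)) @ \oo --> (0 : R).
Proof.
move=> y0; have M0 := maddox_M_gt0.
have := @cvg0_powR R _ (fun n => (p n)^-1) M^-1 _ _ _ y0.
under eq_fun do rewrite -powRrM mulfV ?gt_eqF // powRr1 ?modulus_ge0 //.
apply; first by rewrite invr_gt0.
- by move=> n; rewrite lef_pV2 ?posrE // le_maddox_M.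
- by move=> n; rewrite powR_ge0.
Qed.

Lemma le_paranorm_sup x n :
  ((modulus (ltri_apply P x n) `^ (p n / M))%:E <= paranorm_sup P p x)%E.
Proof. by apply: ereal_sup_ubound; exists n. Qed.

Lemma le_paranorm_sum x n :
  ((modulus (ltri_apply P x n) `^ (p n / M))%:E <= paranorm_sum P p x)%E.
Proof.
rewrite powRrM -poweR_EFin; have M0 := maddox_M_gt0.
have F0 k : (0 <= (modulus (ltri_apply P x k) `^ p k)%:E)%E.
  by rewrite lee_fin powR_ge0.
apply: gt0_ler_poweR; rewrite ?in_itv /= ?leey ?andbT ?invr_ge0 ?(ltW M0) //.
  by apply: nneseries_ge0 => k _ _.
apply: (@le_trans _ _ (\sum_(0 <= k < n.+1)
   (modulus (ltri_apply P x k) `^ p k)%:E)%E).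
  by rewrite big_nat_recr //= leeDr // sume_ge0.
by apply: nneseries_lim_ge => k _ _.
Qed.

Lemma paranorm_sup_ge0 x : (0 <= paranorm_sup P p x)%E.
Proof.
by apply: le_trans (le_paranorm_sup x 0); rewrite lee_fin powR_ge0.
Qed.

Lemma paranorm_sum_ge0 x : (0 <= paranorm_sum P p x)%E.
Proof. exact: poweR_ge0. Qed.

(** The powers |y_n|^(p_n / M) are the M-th roots of a null sequence, hence form
    a null sequence, and h (X k) is the supremum of those of index n > k. *)
Lemma paranorm_sup_tail y X : maddox_c0 p y ->
  (forall k n, ltri_apply P (X k) n = if (n <= k)%N then 0 else y n) ->
  (fun k => paranorm_sup P p (X k)) @ \oo --> (0 : \bar R)%E.
Proof.
move=> y0 XP; apply/cvge0P => [k|eps eps0]; first exact: paranorm_sup_ge0.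
have M0 := maddox_M_gt0.
have : (fun n => modulus (y n) `^ (p n / M)) @ \oo --> (0 : R).
  under eq_fun do rewrite powRrM.
  apply: (@cvg0_powR _ _ (fun=> M^-1) M^-1) => // [|n].
    by rewrite invr_gt0.
  exact: powR_ge0.
move=> /cvgrPdist_le/(_ _ eps0)[N _ NP]; exists N => // k /= Nk.
apply: ge_ereal_sup => _ [n _ <-]; rewrite lee_fin XP.
case: leqP => kn; first by rewrite modulus0 powR0 ?gt_eqF // ltW.
have := NP n (leq_trans Nk (ltnW kn)).
by rewrite sub0r normrN ger0_norm ?powR_ge0.
Qed.

Lemma paranorm_sum_tail y X : maddox_l p y ->
  (forall k n, ltri_apply P (X k) n = if (n <= k)%N then 0 else y n) ->
  (fun k => paranorm_sum P p (X k)) @ \oo --> (0 : \bar R)%E.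
Proof.
move=> yl XP; apply/cvge0P => [k|eps eps0]; first exact: paranorm_sum_ge0.
have M0 := maddox_M_gt0.
pose F n := (modulus (y n) `^ p n)%:E.
have F0 n : (0 <= F n)%E by rewrite lee_fin powR_ge0.
have tail0 : (fun k => \sum_(k.+1 <= n <oo) F n)%E @ \oo --> (0 : \bar R)%E.
  rewrite (cvg_shiftS (fun k => \sum_(k <= n <oo) F n)%E).
  by apply: nneseries_tail_cvg.
have T0 k : (0 <= \sum_(k.+1 <= n <oo) F n)%E by exact: nneseries_ge0.
have := (cvge0P T0).1 tail0 (eps `^ M); rewrite powR_gt0 // => /(_ isT).
apply: filterS => k.
have <- : (\sum_(0 <= n <oo) (modulus (ltri_apply P (X k) n) `^ p n)%:E =
    \sum_(k.+1 <= n <oo) F n)%E.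
  rewrite (nneseries_split 0 k.+1) => [|n _]; last by rewrite lee_fin powR_ge0.
  rewrite add0n big_nat big1 ?add0e; last first.
    by move=> n /= nk; rewrite XP -ltnS nk modulus0 powR0 ?gt_eqF.
  rewrite -(@nneseries_addn _ F k.+1) // -(@nneseries_addn _ (fun n =>
    (modulus (ltri_apply P (X k) n) `^ p n)%:E) k.+1).
    by apply: eq_eseriesr => n _; rewrite XP leqNgt addnS ltnS leq_addl.
  by move=> n; rewrite lee_fin powR_ge0.
move=> Sk; have -> : eps%:E = ((eps `^ M)%:E `^ M^-1)%E.
  by rewrite poweR_EFin -powRrM mulfV ?gt_eqF // powRr1 // ltW.
apply: gt0_ler_poweR => //; rewrite ?in_itv /= ?leey ?andbT ?invr_ge0 ?(ltW M0) //.
  by apply: nneseries_ge0 => n _ _; rewrite lee_fin powR_ge0.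
by rewrite lee_fin powR_ge0.
Qed.

(** A coordinate that is eventually constant along a sequence tending to 0 in
    a paranorm controlling all the coordinates vanishes: this is the
    source of all the uniqueness statements. *)
Lemma coordinate_eq0 (g : (nat -> K) -> \bar R) X n (c : K) :
  (forall x, ((modulus (ltri_apply P x n) `^ (p n / M))%:E <= g x)%E) ->
  (fun k => g (X k)) @ \oo --> (0 : \bar R)%E ->
  (\forall k \near \oo, ltri_apply P (X k) n = c) -> c = 0.
Proof.
move=> leg gX Xc; apply/eqP; rewrite -modulus_eq0.
have g0 k : (0 <= g (X k))%E.
  by apply: le_trans (leg _); rewrite lee_fin powR_ge0.
apply: contraT => cn0.
have d0 : 0 < modulus c `^ (p n / M).
  by rewrite powR_gt0 // lt_neqAle eq_sym cn0 modulus_ge0.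
have := (cvge0P g0).1 gX _ (divr_gt0 d0 (ltr0Sn _ 1)) => gle.
have [N _ NP] := filterI gle Xc.
have [gN XN] := NP N (leqnn N).
have := le_trans (leg (X N)) gN; rewrite XN lee_fin.
by rewrite ler_pdivlMr // ger_pMr // leNgt ltr1n.
Qed.

End Paranorms.

(** * The expansions *)

Section Expansions.
Variables (R : realType) (kd : scalar_kind).
Local Notation K := (scalar_field R kd).
Variable p : nat -> R.
Hypotheses (p_bounded : bounded_fun p) (p_gt0 : forall k, 0 < p k).
Variables (r s t : nat -> K) (u v : K).
Hypotheses (r_neq0 : forall n, r n != 0) (t_neq0 : forall n, t n != 0).
Hypotheses (s0_neq0 : s 0%N != 0) (u_neq0 : u != 0).
Local Notation P := (mxAB r s t u v).
Local Notation b := (basis_seq r s t u v).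
Local Notation bN1 := (basis_seqN1 r s t u v).
Implicit Types (x mu : nat -> K).

Lemma ltri_apply_partial_sum mu m n :
  ltri_apply P (\sum_(0 <= j < m) mu j *: b j) n =
  if (n < m)%N then mu n else 0.
Proof.
rewrite ltri_apply_sum.
under eq_bigr do rewrite ltri_applyZ ltri_apply_basis_seq //.
case: ltnP => [nm|mn].
  rewrite (big_cat_nat (n := n.+1)) //= big_nat_recr //= eqxx mulr1.
  rewrite big_nat big1 ?add0r => [|j /= jn]; last by rewrite gtn_eqF ?mulr0.
  rewrite big_nat big1 ?addr0 // => j /andP[nj _].
  by rewrite ltn_eqF ?mulr0.
rewrite big_nat big1 // => j /= jm.
by rewrite gtn_eqF ?mulr0 // (leq_trans jm).
Qed.

Lemma ltri_apply_remainder x mu k n :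
  ltri_apply P (x - \sum_(0 <= j < k.+1) mu j *: b j) n =
  ltri_apply P x n - (if (n <= k)%N then mu n else 0).
Proof. by rewrite ltri_applyB ltri_apply_partial_sum. Qed.

Lemma ltri_apply_remainderN1 x (mu0 : K) mu k n :
  ltri_apply P (x - (mu0 *: bN1 + \sum_(0 <= j < k.+1) mu j *: b j)) n =
  ltri_apply P x n - mu0 - (if (n <= k)%N then mu n else 0).
Proof.
rewrite ltri_applyB ltri_applyD ltri_applyZ ltri_apply_basis_seqN1 //.
by rewrite mulr1 ltri_apply_partial_sum ltnS opprD addrA.
Qed.

Lemma maddox_c0_unit j : maddox_c0 p (fun n => (n == j)%:R : K).
Proof.
rewrite /maddox_c0 /= -(cvg_shiftn j.+1).
under eq_fun => n.
  rewrite gtn_eqF ?addnS ?ltnS ?leq_addl // modulus0 powR0 ?gt_eqF //.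
  over.
exact: cvg_cst.
Qed.

Lemma maddox_l_unit j : maddox_l p (fun n => (n == j)%:R : K).
Proof.
rewrite /maddox_l /= (nneseries_split 0 j.+1) => [|n _]; last first.
  by rewrite lee_fin powR_ge0.
rewrite [X in (_ + X)%E]eseries0 ?adde0 ?sumEFin ?ltry // => n + _.
by rewrite add0n => jn; rewrite gtn_eqF // modulus0 powR0 ?gt_eqF.
Qed.

Lemma maddox_c0_c (y : nat -> K) (l : K) :
  maddox_c0 p (fun k => y k - l) -> maddox_c p y.
Proof.
move=> yl; exists (to_complex l); move: yl; rewrite /maddox_c0 /=.
by under eq_fun do rewrite /modulus to_complexB.
Qed.

Lemma basis_seq_image j : ltri_apply P (b j) = (fun n => (n == j)%:R).
Proof. by apply/funext => n; rewrite ltri_apply_basis_seq. Qed.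

Lemma represents_unique (g : (nat -> K) -> \bar R) x mu :
  (forall z n, ((modulus (ltri_apply P z n) `^ (p n / maddox_M p))%:E
     <= g z)%E) ->
  represents g b x mu -> mu = ltri_apply P x.
Proof.
move=> leg xmu; apply/funext => n; apply/esym/eqP; rewrite -subr_eq0; apply/eqP.
apply: (coordinate_eq0 (fun z => leg z n) xmu).
by exists n => // k /= nk; rewrite ltri_apply_remainder nk.
Qed.

(** What is common to c_0(p) and l(p): the partial sums of the expansion
    agree with [x] in the first coordinates after applying the matrix, so the
    claim reduces to the smallness of tails. *)
Lemma schauder_basis_tail (Y : set (nat -> K)) (g : (nat -> K) -> \bar R) :
  (forall j, Y (fun n => (n == j)%:R)) ->
  (forall z n, ((modulus (ltri_apply P z n) `^ (p n / maddox_M p))%:E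
     <= g z)%E) ->
  (forall y X, Y y ->
    (forall k n, ltri_apply P (X k) n = if (n <= k)%N then 0 else y n) ->
    (fun k => g (X k)) @ \oo --> (0 : \bar R)%E) ->
  schauder_basis (mx_domain P Y) g b /\
  (forall x, mx_domain P Y x ->
     represents g b x (ltri_apply P x) /\
     (forall mu, represents g b x mu -> mu = ltri_apply P x)).
Proof.
move=> Yunit leg tailg.
have rep x : mx_domain P Y x -> represents g b x (ltri_apply P x).
  move=> Yx; apply: (tailg _ _ Yx) => k n; rewrite ltri_apply_remainder.
  by case: ifP => _; rewrite ?subrr ?subr0.
have uniq x mu := @represents_unique g x mu leg.
split=> [|x Yx]; last by split; [exact: rep | exact: uniq].
split=> [j|x Yx]; first by rewrite /mx_domain /= basis_seq_image.
by exists (ltri_apply P x); split=> [|mu /uniq ->//]; exact: rep.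
Qed.

(** A partial sum over the family starting at b^(-1) has one more term than
    a partial sum over the b^(j), hence the shift by one. *)
Lemma representsN1E (g : (nat -> K) -> \bar R) x mu :
  represents g (basis_seq_fromN1 r s t u v) x mu <->
  (fun k => g (x - (mu 0%N *: bN1 +
     \sum_(0 <= j < k.+1) mu j.+1 *: b j))) @ \oo --> (0 : \bar R)%E.
Proof.
rewrite /represents -cvg_shiftS.
by under eq_fun => k do rewrite big_nat_recl //.
Qed.

Lemma representsN1_unique x (mu0 : K) mu :
  (fun k => paranorm_sup P p (x - (mu0 *: bN1 +
     \sum_(0 <= j < k.+1) mu j *: b j))) @ \oo --> (0 : \bar R)%E ->
  ltri_apply P x @ \oo --> mu0 /\
  (forall j, mu j = ltri_apply P x j - mu0).
Proof.
move=> xmu.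
have muE j : mu j = ltri_apply P x j - mu0.
  apply/esym/eqP; rewrite -subr_eq0; apply/eqP.
  apply: (coordinate_eq0 (fun z => le_paranorm_sup p P z j) xmu).
  by exists j => // k /= jk; rewrite ltri_apply_remainderN1 jk.
split=> //; apply: cvg_modulus.
(* The coordinates of index n > k of the k-th remainder are nu_n - mu0: a
   single remainder with small h bounds all of them at once. *)
have M0 := maddox_M_gt0 p.
have nu0 : (fun n => modulus (ltri_apply P x n - mu0) `^ (p n / maddox_M p))
    @ \oo --> (0 : R).
  apply/cvgrPdist_le => eps eps0.
  have hle := (cvge0P (fun k => paranorm_sup_ge0 p P _)).1 xmu _ eps0.
  have [N _ /(_ N (leqnn N)) /= NP] := hle.
  exists N.+1 => // n /= Nn; rewrite sub0r normrN ger0_norm ?powR_ge0 //.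
  have := le_trans (le_paranorm_sup p P _ n) NP.
  by rewrite ltri_apply_remainderN1 leqNgt Nn subr0 lee_fin.
have := @cvg0_powR R _ (fun n => (p n / maddox_M p)^-1) 1 ltr01 _ _ nu0.
under eq_fun do rewrite -powRrM mulfV ?gt_eqF ?divr_gt0 // powRr1 ?modulus_ge0 //.
apply=> n; last exact: powR_ge0.
by rewrite invf_div ler_pdivlMr ?mul1r ?le_maddox_M.
Qed.

Lemma schauder_basis_c :
  schauder_basis (mx_domain P (maddox_c p)) (paranorm_sup P p)
    (basis_seq_fromN1 r s t u v) /\
  (forall x, mx_domain P (maddox_c p) x ->
     let ell := limn (ltri_apply P x) in
     cvgn (ltri_apply P x) /\
     (fun k => paranorm_sup P p (x - (ell *: bN1 +
        \sum_(0 <= j < k.+1) (ltri_apply P x j - ell) *: b j)))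
       @ \oo --> (0 : \bar R)%E /\
     (forall (mu0 : K) mu,
        (fun k => paranorm_sup P p (x - (mu0 *: bN1 +
           \sum_(0 <= j < k.+1) mu j *: b j))) @ \oo --> (0 : \bar R)%E ->
        mu0 = ell /\ (forall j, mu j = ltri_apply P x j - ell))).
Proof.
set Q := (X in _ /\ X); have HQ : Q.
  move=> x /(maddox_c_limit p_gt0)[l xl] ell.
  have nul : ltri_apply P x @ \oo --> l.
    exact/cvg_modulus/(maddox_c0_modulus p_bounded p_gt0 xl).
  have ellE : ell = l by exact/cvg_lim.
  split; first by apply/cvg_ex; exists l.
  split=> [|mu0 mu /representsN1_unique[numu0 muE]].
    apply: (paranorm_sup_tail p_gt0 xl) => k n.
    rewrite ltri_apply_remainderN1 ellE.
    by case: ifP => _; rewrite ?subrr ?subr0.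
  have <- : mu0 = ell by apply/esym/cvg_lim.
  by [].
split=> //; split=> [[|j]|x Yx].
- apply: (@maddox_c0_c _ 1); rewrite /maddox_c0 /=.
  under eq_fun do rewrite ltri_apply_basis_seqN1 // subrr modulus0
    powR0 ?gt_eqF //.
  exact: cvg_cst.
- apply: (@maddox_c0_c _ 0); rewrite /= basis_seq_image.
  under eq_fun do rewrite subr0.
  exact: maddox_c0_unit.
have [_ [xell uniq]] := HQ x Yx.
exists (fun m => if m is j.+1 then ltri_apply P x j - limn (ltri_apply P x)
  else limn (ltri_apply P x)); split; first exact/representsN1E.
move=> mu /representsN1E/uniq[mu0 muE].
by apply/funext => -[|j]; rewrite ?muE.
Qed.

End Expansions.

Theorem theorem4p3 (R : realType) (kd : scalar_kind) (p : nat -> R)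
  (p_bounded : bounded_fun p) (p_gt0 : forall k, 0 < p k)
  (r s t : nat -> scalar_field R kd) (u v : scalar_field R kd)
  (r_neq0 : forall n, r n != 0) (t_neq0 : forall n, t n != 0)
  (s0_neq0 : s 0%N != 0) (u_neq0 : u != 0) (v_neq0 : v != 0) :
  let P := mxAB r s t u v in
  let nu := fun x : nat -> scalar_field R kd => ltri_apply P x in
  let b := basis_seq r s t u v in
  let bN1 := basis_seqN1 r s t u v in
  let h := paranorm_sup P p in
  let h' := paranorm_sum P p in
  (schauder_basis (mx_domain P (maddox_c0 p)) h b /\
   (forall x, mx_domain P (maddox_c0 p) x ->
     represents h b x (nu x) /\
     (forall mu, represents h b x mu -> mu = nu x))) /\
  (schauder_basis (mx_domain P (maddox_l p)) h' b /\
   (forall x, mx_domain P (maddox_l p) x ->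
     represents h' b x (nu x) /\
     (forall mu, represents h' b x mu -> mu = nu x))) /\
  (schauder_basis (mx_domain P (maddox_c p)) h (basis_seq_fromN1 r s t u v) /\
   (forall x, mx_domain P (maddox_c p) x ->
     let ell := limn (nu x) in
     cvgn (nu x) /\
     (fun k => h (x - (ell *: bN1 +
        \sum_(0 <= j < k.+1) (nu x j - ell) *: b j))) @ \oo --> (0 : \bar R)%E /\
     (forall (mu0 : scalar_field R kd) (mu : nat -> scalar_field R kd),
        (fun k => h (x - (mu0 *: bN1 +
           \sum_(0 <= j < k.+1) mu j *: b j))) @ \oo --> (0 : \bar R)%E ->
        mu0 = ell /\ (forall j, mu j = nu x j - ell)))).
Proof.
move=> P nu b bN1 h h'; split; last split.
- apply: schauder_basis_tail => //.
  + exact: maddox_c0_unit.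
  + exact: le_paranorm_sup.
  + exact: paranorm_sup_tail.
- apply: schauder_basis_tail => //.
  + exact: maddox_l_unit.
  + exact: le_paranorm_sum.
  + exact: paranorm_sum_tail.
- exact: schauder_basis_c.
Qed.
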